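(* Let $\Lambda_0\colon\mathbb{R}\to\mathbb{R}$ have bounded variation, and let $\lambda\in(0,1]$ and $G\in\mathcal M$ be such that $$(1-\lambda)G\le\Lambda_0\le\lambda+(1-\lambda)G\quad\text{pointwise on }\mathbb{R}.$$ Then $\Lambda:=\tfrac1\lambda\big(\Lambda_0-(1-\lambda)G\big)$ is $[0,1]$-valued, has bounded variation, and for all $F\in\mathcal M$, $$Q_{\Lambda_0}^{-}\big(\lambda F+(1-\lambda)G\big)=Q_\Lambda^{-}(F)\quad\text{and}\quad Q_{\Lambda_0}^{+}\big(\lambda F+(1-\lambda)G\big)=Q_\Lambda^{+}(F).$$ Moreover, if $\Lambda_0$ is right lower semicontinuous (i.e. $\liminf_{y\downarrow x}\Lambda_0(y)\ge\Lambda_0(x)$ for all $x\in\mathbb{R}$), then so is $\Lambda$.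
   Context: $\mathcal M$ is the set of cumulative distribution functions on $\mathbb{R}$. For a function $\Lambda$ on $\mathbb{R}$ and $F\in\mathcal M$, $Q_\Lambda^-(F):=\inf\{x\in\mathbb{R}\mid F(x)\ge\Lambda(x)\}$ and $Q_\Lambda^+(F):=\inf\{x\in\mathbb{R}\mid F(x)>\Lambda(x)\}$, with values in $[-\infty,\infty]$ and $\inf\varnothing=\infty$. A function $f\colon\mathbb R\to\mathbb R$ has bounded variation if $\sup\{\sum_{i=1}^n|f(x_i)-f(x_{i-1})| : n\in\mathbb{N},\ x_0<\dots<x_n\}<\infty$. *)

(* Defs.v *)
From mathcomp Require Import all_boot all_order all_algebra.
From mathcomp Require Import all_classical all_reals all_analysis.

Set Implicit Arguments.
Unset Strict Implicit.
Unset Printing Implicit Defensive.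

Import Order.TTheory GRing.Theory Num.Theory.
Import numFieldNormedType.Exports.

Local Open Scope classical_set_scope.
Local Open Scope ring_scope.

(* The set of cumulative distribution functions on the real line is the type
   [cumulativeBounded 0 1] of nondecreasing right-continuous functions with
   limits 0 at -oo and 1 at +oo.  The Lambda-quantiles take a bare function as
   argument, so that they apply directly to mixtures of such functions. *)

Definition lambda_quantile_lower {R : realType} (Lambda F : R -> R) : \bar R :=
  ereal_inf [set x%:E | x in [set x | Lambda x <= F x]].

Definition lambda_quantile_upper {R : realType} (Lambda F : R -> R) : \bar R :=
  ereal_inf [set x%:E | x in [set x | Lambda x < F x]].

(* Bounded variation on the whole line, unlike [bounded_variation a b f].
   Points x_0 < ... < x_n are a :: s with [itv_partition a b s], where a = x_0
   and b = x_n, so the union below ranges over all of them. *)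
Definition bounded_variation_line {R : realType} (f : R -> R) : Prop :=
  (ereal_sup [set v%:E | v in
     \bigcup_(ab in [set: R * R]) variations ab.1 ab.2 f] < +oo)%E.

(* The filter x^'+ excludes x itself. *)
Definition right_lower_semicontinuous {R : realType} (f : R -> R) : Prop :=
  forall x : R, ((f x)%:E <= limf_einf (EFin \o f) x^'+)%E.

(* Main.v *)
Require Import Defs.
From mathcomp Require Import all_boot all_order all_algebra.
From mathcomp Require Import all_classical all_reals all_analysis.
From mathcomp Require Import lra.

Import Order.TTheory GRing.Theory Num.Theory.
Import numFieldNormedType.Exports.

Local Open Scope classical_set_scope.
Local Open Scope ring_scope.

(** Since [lambda] is positive, [Lambda x <= F x] is equivalent to [Lambda0 x <= lambda * F x + (1 -
    lambda) * G x], and likewise for the strict inequalities. So each pair of quantiles is the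
    infimum of one and the same set, and the bounds on [Lambda0] rearrange in the same way to
    [0 <= Lambda x <= 1]. The two regularity claims are closure properties: [Lambda] is a positive
    multiple of the sum of [Lambda0] and a multiple of [G], where [G] has bounded variation because
    it is monotone and bounded, and is right-continuous. *)

Lemma bounded_variation_lineP (R : realType) (f : R -> R) :
  bounded_variation_line f <->
  exists M, forall a b s, itv_partition a b s -> variation a b f s <= M.
Proof.
split=> [|[M fM]].
- rewrite /bounded_variation_line; set S := [set _ | _ in _] => Sfin.
  have Sub a b s : itv_partition a b s ->
      ((variation a b f s)%:E <= ereal_sup S)%E.
    move=> abs; apply: ereal_sup_ubound; exists (variation a b f s) => //.
    by exists (a, b) => //; exact: variations_variation.
  (* The empty partition of the degenerate interval at 0 keeps the supremum away from -oo, so [fine]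
     returns its true value and not a default. *)
  have S0 : (0%:E <= ereal_sup S)%E.
    by have := Sub 0 0 [::]; rewrite variation_nil; apply; split.
  exists (fine (ereal_sup S)) => a b s /Sub.
  by rewrite -lee_fin fineK// ge0_fin_numE.
- apply: (@le_lt_trans _ _ M%:E); last exact: ltry.
  apply: ge_ereal_sup => _ [_ [[a b] _ [s abs <-]] <-].
  by rewrite lee_fin; exact: fM.
Qed.

Lemma bounded_variation_lineD (R : realType) (f g : R -> R) :
  bounded_variation_line f -> bounded_variation_line g ->
  bounded_variation_line (f \+ g).
Proof.
move=> /bounded_variation_lineP[M fM] /bounded_variation_lineP[N gN].
apply/bounded_variation_lineP; exists (M + N) => a b s abs.
by apply: (le_trans (variation_le _ _ _ _ _)); rewrite lerD ?fM ?gN.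
Qed.

Lemma bounded_variation_lineZ (R : realType) (c : R) (f : R -> R) :
  bounded_variation_line f -> bounded_variation_line (fun x => c * f x).
Proof.
move=> /bounded_variation_lineP[M fM].
apply/bounded_variation_lineP; exists (`|c| * M) => a b s abs.
suff -> : variation a b (fun x => c * f x) s = `|c| * variation a b f s.
  by rewrite ler_wpM2l// fM.
rewrite /variation mulr_sumr; apply: eq_bigr => i _.
by rewrite /= -mulrBr normrM.
Qed.

(** The variation of a nondecreasing function telescopes to [G b - G a], and the limits of [G] at
    the two infinities give [G b <= r] and [l <= G a]. *)
Lemma bounded_variation_line_cumulative (R : realType) (l r : R)
    (G : cumulativeBounded l r) : bounded_variation_line G.
Proof.
have Gnd := cumulative_is_nondecreasing G.
apply/bounded_variation_lineP; exists (r - l) => a b s abs.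
rewrite nondecreasing_variation//; last by move=> x y _ _; exact: Gnd.
apply: lerB.
- apply: cvgr_to_ge (cumulativey G) _.
  by apply: filterS (nbhs_pinfty_ge (num_real b)) => x; exact: Gnd.
- apply: cvgr_to_le (cumulativeNy G) _.
  by apply: filterS (nbhs_ninfty_le (num_real a)) => x; exact: Gnd.
Qed.

(** The lower limit is the supremum, over sets [V] of the filter, of the infimum of [f] on [V]. If
    it exceeds [f x - e], so does the infimum on some [V]; conversely, the set where [f y] exceeds
    [f x - e] serves as [V]. *)
Lemma right_lower_semicontinuousP (R : realType) (f : R -> R) :
  right_lower_semicontinuous f <->
  forall x e, 0 < e -> \forall y \near x^'+, f x - e < f y.
Proof.
split=> [fx x e e0|H x].
- have := fx x; rewrite limf_einfE => fxs.
  have : ((f x - e)%:E < ereal_sup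
      [set ereal_inf [set (EFin \o f) y | y in V] | V in x^'+])%E.
    by apply: lt_le_trans fxs; rewrite lte_fin ltrBlDr ltrDl.
  move=> /ereal_sup_gt[_ [V xV <-]] Vlt.
  apply: filterS xV => y Vy; rewrite -lte_fin; apply: (lt_le_trans Vlt).
  by apply: ereal_inf_lbound; exists y.
- rewrite limf_einfE; apply/lee_subgt0Pr => e e0.
  apply: (@le_trans _ _ (ereal_inf
    [set (EFin \o f) y | y in [set y | f x - e < f y]])).
    by apply: le_ereal_inf_tmp => _ [y /= /ltW xy <-]; rewrite lee_fin.
  apply: ereal_sup_ubound.
  by exists [set y | f x - e < f y] => //; exact: H.
Qed.

Lemma right_lower_semicontinuousD (R : realType) (f g : R -> R) :
  right_lower_semicontinuous f -> right_lower_semicontinuous g ->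
  right_lower_semicontinuous (f \+ g).
Proof.
move=> /right_lower_semicontinuousP fl /right_lower_semicontinuousP gl.
apply/right_lower_semicontinuousP => x e e0.
have e20 : 0 < e / 2 by rewrite divr_gt0.
apply: filterS2 (fl x _ e20) (gl x _ e20) => y /=; lra.
Qed.

Lemma right_lower_semicontinuousZ (R : realType) (c : R) (f : R -> R) :
  0 < c -> right_lower_semicontinuous f ->
  right_lower_semicontinuous (fun x => c * f x).
Proof.
move=> c0 /right_lower_semicontinuousP fl.
apply/right_lower_semicontinuousP => x e e0.
apply: filterS (fl x (e / c) (divr_gt0 e0 c0)) => y.
by rewrite -(ltr_pM2l c0) mulrBr mulrCA divff ?gt_eqF// mulr1.
Qed.

Lemma right_continuous_lower_semicontinuous (R : realType) (f : R -> R) :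
  right_continuous f -> right_lower_semicontinuous f.
Proof.
move=> fc; apply/right_lower_semicontinuousP => x e e0.
move/cvgrPdist_lt: (fc x) => /(_ e e0); apply: filterS => y.
rewrite ltr_norml; lra.
Qed.

Theorem proposition7p4 (R : realType) (Lambda0 : R -> R)
    (bvLambda0 : bounded_variation_line Lambda0)
    (lambda : R) (lambda_gt0 : 0 < lambda) (lambda_le1 : lambda <= 1)
    (G : cumulativeBounded (0 : R) (1 : R))
    (Lambda0_bounds : forall x : R,
       (1 - lambda) * G x <= Lambda0 x <= lambda + (1 - lambda) * G x) :
  let Lambda := fun x : R => lambda^-1 * (Lambda0 x - (1 - lambda) * G x) in
  [/\ forall x : R, 0 <= Lambda x <= 1,
      bounded_variation_line Lambda,
      forall F : cumulativeBounded (0 : R) (1 : R),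
        let mix := fun x : R => lambda * F x + (1 - lambda) * G x in
        lambda_quantile_lower Lambda0 mix = lambda_quantile_lower Lambda F /\
        lambda_quantile_upper Lambda0 mix = lambda_quantile_upper Lambda F
    & right_lower_semicontinuous Lambda0 -> right_lower_semicontinuous Lambda].
Proof.
move=> Lambda.
(* Subtraction becomes addition of a multiple of [G], the form that the closure lemmas accept. *)
have LambdaE : Lambda =
    fun x => lambda^-1 * (Lambda0 \+ (fun y => (lambda - 1) * G y)) x.
  by apply/funext => x; rewrite /Lambda /= -mulNr opprB.
split.
- move=> x; have /andP[lb ub] := Lambda0_bounds x.
  rewrite /Lambda mulr_ge0 ?invr_ge0 ?(ltW lambda_gt0) ?subr_ge0//=.
  by rewrite ler_pdivrMl// mulr1 lerBlDr.
- rewrite LambdaE; apply: bounded_variation_lineZ.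
  apply: bounded_variation_lineD => //; apply: bounded_variation_lineZ.
  exact: bounded_variation_line_cumulative.
- move=> F mix; split; congr (ereal_inf (image _ EFin));
    apply/funext => x /=; apply/propext.
    by rewrite /mix /Lambda ler_pdivrMl// lerBlDr.
  by rewrite /mix /Lambda ltr_pdivrMl// ltrBlDr.
- move=> rl; rewrite LambdaE; apply: right_lower_semicontinuousZ.
    by rewrite invr_gt0.
  apply: right_lower_semicontinuousD => //.
  apply: right_continuous_lower_semicontinuous => x.
  apply: cvgM; first exact: cvg_cst.
  exact: cumulative_is_right_continuous.
Qed.
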